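(* Let $\Gamma=\langle\alpha,\beta\rangle$ be a numerical semigroup, where $\alpha<\beta$. Let $\mathbb{F}$ be an arbitrary field, let $R=\mathbb{F}[t^\alpha,t^\beta]\subseteq\mathbb{F}[t]$, let $I$ be a $\Gamma$-lean set, and let $M_I=\sum_{i\in I}R\,t^i\subseteq\mathbb{F}[t]$. Then the minimal graded free resolution of the graded $R$-module $M_I$ is, up to a shift, periodic of period $2$.
   Context: Here $\mathbb{N}=\{0,1,2,\ldots\}$. A numerical semigroup $\Gamma$ is a submonoid of $(\mathbb{N},+)$ with $\mathbb{N}\setminus\Gamma$ finite; the elements of $\mathbb{N}\setminus\Gamma$ are called gaps. $\langle\alpha,\beta\rangle=\{r\alpha+s\beta : r,s\in\mathbb{N}\}$; this is a numerical semigroup exactly when the positive integers $\alpha,\beta$ are coprime. A $\Gamma$-lean set is a finite subset of $\mathbb{N}$ containing $0$ whose nonzero elements are gaps of $\Gamma$ and such that the positive difference of any two distinct nonzero elements is again a gap of $\Gamma$. The polynomial ring $\mathbb{F}[t]$ is graded by $\deg t=1$; $R$ is a graded subalgebra and $M_I$ is a graded $R$-submodule of $\mathbb{F}[t]$. ''Up to a shift'' refers to a shift of the grading.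
   Formalization: For I = {0} the module M_I = R is free, its minimal resolution is R in degree 0 only, and the claimed periodicity fails; in that case periodicity is asserted only from homological degree 1 on, while for every other lean set I it is asserted from degree 0. *)

(* Defs.v *)
From mathcomp Require Import all_boot all_order all_algebra.
From mathcomp Require Import finmap.
From mathcomp Require Import mathcomp_extra boolp classical_sets functions cardinality.

Set Implicit Arguments.
Unset Strict Implicit.
Unset Printing Implicit Defensive.

Import GRing.Theory Num.Theory.
Local Open Scope classical_set_scope.
Local Open Scope ring_scope.

Definition numerical_semigroup (G : set nat) : Prop :=
  [/\ G 0%N, forall m n : nat, G m -> G n -> G (m + n)%N & finite_set (~` G)].

Definition semigroup2 (a b : nat) : set nat :=
  [set n | exists r s : nat, n = (r * a + s * b)%N].

Definition gap (G : set nat) : set nat := ~` G.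

Definition lean_set (G : set nat) (I : {fset nat}) : Prop :=
  [/\ 0%N \in I,
      forall i : nat, i \in I -> i != 0%N -> gap G i
    & forall i j : nat, i \in I -> j \in I -> i != 0%N -> j != 0%N ->
        (i < j)%N -> gap G (j - i)%N].

Section Graded.
Variable F : fieldType.

(* The subalgebra F[t^a, t^b] of F[t]: all Q(t^a, t^b) with Q in F[x][y]. *)
Definition subalg2 (a b : nat) : set {poly F} :=
  range (fun Q : {poly {poly F}} =>
           (map_poly (fun c : {poly F} => c \Po 'X^a) Q).['X^b]).

Definition submod_gen (S : set {poly F}) (I : {fset nat}) : set {poly F} :=
  [set p | exists2 c : nat -> {poly F},
     forall i, S (c i) & p = \sum_(i <- I) c i * 'X^i].

(* Degrees are integers; 0 is homogeneous of every degree. *)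
Definition homog (d : int) (p : {poly F}) : Prop :=
  forall k : nat, p`_k != 0 -> k%:Z = d.

(* From here on, S is a graded subalgebra of F[t] and N a graded S-submodule
   of F[t]. A value E of this type stands for the graded free module
   \bigoplus_j S(- gdeg E j): the row vectors of size rk E with entries in S,
   the j-th standard basis vector having degree gdeg E j. *)
Record graded_free := GradedFree { rk : nat; gdeg : 'I_rk -> int }.

(* The twist E(-s). *)
Definition gshift (s : int) (E : graded_free) : graded_free :=
  GradedFree (fun j : 'I_(rk E) => gdeg j + s).

Definition free_elt (S : set {poly F}) (n : nat) (v : 'rV[{poly F}]_n) : Prop :=
  forall j, S (v 0 j).

(* Homomorphisms v |-> v *m A that are S-linear and homogeneous of degree 0. *)
Definition graded_hom (S : set {poly F}) (E E' : graded_free)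
    (A : 'M[{poly F}]_(rk E, rk E')) : Prop :=
  forall i j, S (A i j) /\ homog (gdeg i - gdeg j) (A i j).

Definition graded_iso (S : set {poly F}) (E E' : graded_free)
    (A : 'M[{poly F}]_(rk E, rk E')) : Prop :=
  graded_hom S A /\
  exists B : 'M[{poly F}]_(rk E', rk E),
    [/\ graded_hom S B, A *m B = 1%:M & B *m A = 1%:M].

(* ... -> res_mod 2 -> res_mod 1 -> res_mod 0 -> F[t], the last map being
   v |-> v *m res_aug. *)
Record resolution := Resolution {
  res_mod : nat -> graded_free;
  res_diff : forall n : nat,
    'M[{poly F}]_(rk (res_mod n.+1), rk (res_mod n));
  res_aug : 'cV[{poly F}]_(rk (res_mod 0)) }.

Definition graded_free_resolution (S N : set {poly F}) (r : resolution) : Prop :=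
  [/\ forall n, graded_hom S (res_diff r n),
      forall j, N (res_aug r j 0) /\ homog (gdeg j) (res_aug r j 0),
      forall p, N p ->
        exists2 v : 'rV_(rk (res_mod r 0)),
          free_elt S v & p = (v *m res_aug r) 0 0,
      forall v : 'rV_(rk (res_mod r 0)), free_elt S v ->
        (v *m res_aug r = 0 <->
         exists2 w, free_elt S w & v = w *m res_diff r 0)
    & forall (n : nat) (v : 'rV_(rk (res_mod r n.+1))), free_elt S v ->
        (v *m res_diff r n = 0 <->
         exists2 w, free_elt S w & v = w *m res_diff r n.+1)].

(* The homogeneous maximal ideal, spanned by the elements of S of positive
   degree. *)
Definition irrelevant_ideal (S : set {poly F}) : set {poly F} :=
  [set p | S p /\ p`_0 = 0].

(* Minimality: the image of each differential lies in m times its target. *)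
Definition minimal_graded_free_resolution (S N : set {poly F})
    (r : resolution) : Prop :=
  graded_free_resolution S N r /\
  forall (n : nat) (w : 'rV_(rk (res_mod r n.+1))), free_elt S w ->
    free_elt (irrelevant_ideal S) (w *m res_diff r n).

(* From homological degree k on, the complex is isomorphic, as a complex of
   graded S-modules, to its own translate by two steps, up to one fixed twist
   of the grading. *)
Definition periodic2_from (S : set {poly F}) (k : nat) (r : resolution) : Prop :=
  exists (s : int)
    (P : forall n : nat, 'M[{poly F}]_(rk (res_mod r n.+2), rk (res_mod r n))),
  forall n : nat, (k <= n)%N ->
    @graded_iso S (res_mod r n.+2) (gshift s (res_mod r n)) (P n) /\
    res_diff r n.+2 *m P n = P n.+1 *m res_diff r n.

End Graded.

Arguments subalg2 F a b : clear implicits.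

(* Main.v *)
Require Import Defs.
From mathcomp Require Import all_boot all_order all_algebra.
From mathcomp Require Import finmap.
From mathcomp Require Import mathcomp_extra boolp classical_sets functions cardinality.
From mathcomp Require Import zify ring.

(** Write G for the semigroup generated by a and b. An exponent d = p a + q b
is a lattice point (p, q), determined up to translation by (b, -a), and t^d
lies in R t^c exactly when some point of d dominates a given point of c in both
coordinates. Leanness says that no t^i with i in I divides another one in this
sense. Hence, if every i in I is lifted to the point (x, -z) with 0 <= x < b,
the lifts sorted by abscissa form a descending staircase: x and z both
increase strictly ([lean_staircase]). It begins at the origin, the lift of
0, and is continued by (b, -a), which is again a lift of 0, so that it
describes a cycle of N = |I| corners e_0, ..., e_(N-1).

Two consecutive corners e_k and e_(k+1) are both dominated by the inner corner
s_k = (x_(k+1), -z_k), which gives a relation between the generators t^(e_k)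
and t^(e_(k+1)) of M_I. In a fixed degree d, the generators and relations that
contribute form a subgraph of a cycle with N vertices and N edges. Everything
rests on two facts about this subgraph. It is connected ([reach_path]), so the
N relations generate the kernel of R^N -> M_I. It contains all N edges exactly
when d - ab is the degree of an element of M_I ([reach_all_syz],
[reach_cosyz]), and a cycle graph has nonzero H_1 only if no edge is missing;
so the second syzygy module of M_I is M_I itself, shifted by ab. The resolution
then alternates between the matrix of relations and a rank one matrix, and all
exponents that occur in them are positive as soon as N > 1.

This produces one minimal resolution which repeats literally. Any other one is
isomorphic to it as a graded complex ([minimal_resolution_iso]), by the graded
Nakayama lemma in the form [graded_hom_unipotent], and the isomorphism carries
the periodicity over ([periodic2_transfer]). *)

Set Implicit Arguments.
Unset Strict Implicit.
Unset Printing Implicit Defensive.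

Import Order.TTheory GRing.Theory Num.Theory.
Local Open Scope classical_set_scope.
Local Open Scope ring_scope.

(** * Homogeneous components of polynomials *)

Section HomogeneousComponents.
Variable F : fieldType.
Implicit Types (p q : {poly F}) (d e z : int).

Definition hcomp z p : {poly F} := if z is Posz k then p`_k *: 'X^k else 0.

Lemma hcompD z p q : hcomp z (p + q) = hcomp z p + hcomp z q.
Proof. by case: z => k /=; rewrite ?addr0 // coefD scalerDl. Qed.

Lemma hcomp0 z : hcomp z 0 = 0.
Proof. by case: z => k //=; rewrite coef0 scale0r. Qed.

Lemma hcomp_sum z n (f : 'I_n -> {poly F}) :
  hcomp z (\sum_i f i) = \sum_i hcomp z (f i).
Proof. by apply: (big_morph (hcomp z) (hcompD z)); exact: hcomp0. Qed.

Lemma homog_hcomp z p : homog z (hcomp z p).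
Proof.
case: z => k j /=; rewrite ?coef0 ?eqxx // coefZ coefXn.
by case: (j =P k) => [->//|_]; rewrite mulr0 eqxx.
Qed.

Lemma hcomp_homog d p : homog d p -> hcomp d p = p.
Proof.
move=> hp; apply/polyP => j.
have [pj0|pj0] := eqVneq p`_j 0; last first.
  by rewrite -(hp _ pj0) /= coefZ coefXn eqxx mulr1.
case: d {hp} => k /=; rewrite ?coef0 // coefZ coefXn pj0.
by case: eqP => [<-|_]; rewrite ?mulr0 // pj0 mul0r.
Qed.

Lemma homog0 d : homog d (0 : {poly F}).
Proof. by move=> k; rewrite coef0 eqxx. Qed.

Lemma homogD d p q : homog d p -> homog d q -> homog d (p + q).
Proof.
by move=> hp hq; rewrite -(hcomp_homog hp) -(hcomp_homog hq) -hcompD;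
  exact: homog_hcomp.
Qed.

Lemma homogN d p : homog d p -> homog d (- p).
Proof. by move=> hp k; rewrite coefN oppr_eq0; exact: hp. Qed.

Lemma homogXn d n : n%:Z = d -> homog d ('X^n : {poly F}).
Proof. by move=> <- k; rewrite coefXn; case: (k =P n) => [->//|_]; rewrite eqxx. Qed.

Lemma homog1 : homog 0 (1 : {poly F}).
Proof. by rewrite -(expr0 'X); exact: homogXn. Qed.

Lemma homog_sum d n (f : 'I_n -> {poly F}) :
  (forall i, homog d (f i)) -> homog d (\sum_i f i).
Proof.
by move=> hf; elim/big_ind: _ => [|p q|i _]; [exact: homog0|exact: homogD|].
Qed.

(** Since multiplication by a homogeneous element only shifts components, any
solution of a homogeneous linear system may be replaced by a homogeneous one. *)
Lemma hcompM z e p q : homog e q -> hcomp (z + e) (p * q) = hcomp z p * q.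
Proof.
move=> hq; rewrite -(hcomp_homog hq).
case: e hq => k _ /=; last by rewrite !mulr0 hcomp0.
set c := q`_k; apply/polyP => j.
rewrite -!scalerAr coefZ; have coefE (r : {poly F}) i :
    (c *: (r * 'X^k))`_i = c * (if (i < k)%N then 0 else r`_(i - k)).
  by rewrite coefZ coefMXn.
case: z => l /=.
  rewrite coefZ coefE coefXn -scalerAl coefZ -exprD coefXn ltnNge leq_addl /=.
  by rewrite addnK; ring.
rewrite mul0r coef0 mulr0.
case zE: (Negz l + k%:Z) => [i|i] /=; rewrite ?coef0 // coefZ coefE.
by rewrite (_ : (i < k)%N) ?mulr0 ?mul0r //; lia.
Qed.

Lemma homogM d e p q : homog d p -> homog e q -> homog (d + e) (p * q).
Proof.
by move=> hp hq; rewrite -(hcomp_homog hp) -(hcompM _ _ hq); exact: homog_hcomp.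
Qed.

End HomogeneousComponents.

(** * Graded homomorphisms over a monomial subalgebra *)

Section MonomialAlgebra.
Variables (F : fieldType) (G : set nat).

(** The semigroup algebra of G, spanned by the t^g with g in G. *)
Definition supported : set {poly F} := [set p | forall k, p`_k != 0 -> G k].

Hypothesis G0 : G 0%N.
Hypothesis GD : forall m n, G m -> G n -> G (m + n)%N.

Lemma supported0 : supported 0.
Proof. by move=> k; rewrite coef0 eqxx. Qed.

Lemma supportedXn n : G n -> supported 'X^n.
Proof. by move=> Gn k; rewrite coefXn; case: (k =P n) => [->//|_]; rewrite eqxx. Qed.

Lemma supported1 : supported 1.
Proof. by rewrite -(expr0 'X); exact: supportedXn. Qed.

Lemma supportedD p q : supported p -> supported q -> supported (p + q).
Proof.
move=> Sp Sq k; rewrite coefD.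
have [p0|p0 _] := eqVneq p`_k 0; last exact: Sp.
by rewrite p0 add0r; exact: Sq.
Qed.

Lemma supportedN p : supported p -> supported (- p).
Proof. by move=> Sp k; rewrite coefN oppr_eq0; exact: Sp. Qed.

Lemma supportedZ c p : supported p -> supported (c *: p).
Proof.
by move=> Sp k; rewrite coefZ mulf_eq0 negb_or => /andP[_]; exact: Sp.
Qed.

Lemma supported_sum (T : Type) (s : seq T) (P : pred T) (f : T -> {poly F}) :
  (forall i, P i -> supported (f i)) -> supported (\sum_(i <- s | P i) f i).
Proof.
by move=> Sf; elim/big_ind: _ => [|p q|//]; [exact: supported0|exact: supportedD].
Qed.

Lemma supportedM p q : supported p -> supported q -> supported (p * q).
Proof.
move=> Sp Sq k; rewrite coefM => nz.
have [i /andP[pi qi]] : exists i : 'I_k.+1, (p`_i != 0) && (q`_(k - i) != 0).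
  apply/existsP; apply: contraNT nz => /existsPn nz; apply/eqP.
  rewrite big1 // => i _; apply/eqP; rewrite mulf_eq0.
  by have := nz i; rewrite negb_and !negbK.
by rewrite -(subnKC (ltn_ord i : (i <= k)%N)); apply: GD; [exact: Sp|exact: Sq].
Qed.

Lemma supported_hcomp z p : supported p -> supported (hcomp z p).
Proof.
case: z => k Sp /=; last exact: supported0.
have [->|p0] := eqVneq p`_k 0; first by rewrite scale0r; exact: supported0.
by apply: supportedZ; apply: supportedXn; exact: Sp.
Qed.

Definition mx_supported m n (A : 'M[{poly F}]_(m, n)) :=
  forall i j, supported (A i j).

Lemma mx_supportedM m n q (A : 'M_(m, n)) (B : 'M_(n, q)) :
  mx_supported A -> mx_supported B -> mx_supported (A *m B).
Proof.
move=> SA SB i j; rewrite mxE; apply: supported_sum => k _.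
by apply: supportedM.
Qed.

Lemma free_eltE n (v : 'rV_n) : free_elt supported v <-> mx_supported v.
Proof. by split=> Sv ? //; move=> j; rewrite ord1; apply: Sv. Qed.

Lemma graded_hom_supported (E E' : graded_free) (A : 'M_(rk E, rk E')) :
  graded_hom supported A -> mx_supported A.
Proof. by move=> hA i j; have [] := hA i j. Qed.

Lemma graded_hom1 (E : graded_free) : graded_hom supported (1%:M : 'M_(rk E)).
Proof.
move=> i j; rewrite mxE; case: eqP => [->|_] /=.
  by rewrite subrr; split; [exact: supported1|exact: homog1].
by split; [exact: supported0|exact: homog0].
Qed.

Lemma graded_homD (E E' : graded_free) (A B : 'M_(rk E, rk E')) :
  graded_hom supported A -> graded_hom supported B ->
  graded_hom supported (A + B).
Proof.
move=> hA hB i j; have [SA dA] := hA i j; have [SB dB] := hB i j.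
by rewrite mxE; split; [exact: supportedD|exact: homogD].
Qed.

Lemma graded_homN (E E' : graded_free) (A : 'M_(rk E, rk E')) :
  graded_hom supported A -> graded_hom supported (- A).
Proof.
move=> hA i j; have [SA dA] := hA i j.
by rewrite mxE; split; [exact: supportedN|exact: homogN].
Qed.

Lemma graded_homM (E E' E'' : graded_free) (A : 'M_(rk E, rk E'))
    (B : 'M_(rk E', rk E'')) :
  graded_hom supported A -> graded_hom supported B ->
  graded_hom supported (A *m B).
Proof.
move=> hA hB; split.
  by apply: mx_supportedM; apply: graded_hom_supported.
rewrite mxE; apply: homog_sum => k.
rewrite -(subrKA (gdeg k)).
by apply: homogM; [case: (hA i k)|case: (hB k j)].
Qed.

Lemma graded_homX (E : graded_free) (A : 'M_(rk E)) n :
  graded_hom supported A -> graded_hom supported (A ^+ n : 'M_(rk E)).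
Proof.
move=> hA; elim: n => [|n IHn]; first exact: graded_hom1.
by rewrite exprS; apply: graded_homM.
Qed.

(** The graded Nakayama lemma: 1 - A has no constant terms and is homogeneous, so
it maps each basis vector into the span of those of strictly lower degree; hence
it is nilpotent and the geometric series inverts A. *)
Lemma graded_hom_unipotent (E : graded_free) (A : 'M[{poly F}]_(rk E)) :
  graded_hom supported A ->
  (forall i j, (A i j)`_0 = (i == j)%:R) ->
  exists B : 'M_(rk E), graded_hom supported B /\ A *m B = 1%:M.
Proof.
move=> hA A0; pose N : 'M[{poly F}]_(rk E) := 1%:M - A.
have hN : graded_hom supported N.
  by apply: graded_homD; [exact: graded_hom1|exact: graded_homN].
have N0 i j : (N i j)`_0 = 0.
  rewrite !mxE coefD coefN A0.
  by case: (i =P j) => /= _; rewrite ?coef1 ?coef0 ?subrr ?oppr0 ?addr0.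
have Nlt i j : N i j != 0 -> gdeg j < gdeg i.
  move=> nz; have : lead_coef (N i j) != 0 by rewrite lead_coef_eq0.
  rewrite lead_coefE => nzk; have [_ /(_ _ nzk) dN] := hN i j.
  rewrite -subr_gt0 -dN ltz_nat lt0n; apply: contra_neq nzk => ->.
  exact: N0.
have NX n i j : (N ^+ n : 'M_(rk E)) i j != 0 -> n%:Z <= gdeg i - gdeg j.
  elim: n i j => [|n IHn] i j.
    by rewrite expr0 mxE; case: (i =P j) => [->|_]; rewrite ?eqxx // subrr.
  rewrite exprS mxE => nz.
  have [k /andP[Nik Nkj]] : exists k, (N i k != 0) && ((N ^+ n) k j != 0).
    apply/existsP; apply: contraNT nz => /existsPn nz; apply/eqP.
    rewrite big1 // => k _; apply/eqP; rewrite mulf_eq0.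
    by have := nz k; rewrite negb_and !negbK.
  by have := Nlt _ _ Nik; have := IHn _ _ Nkj; lia.
(* One more than the largest possible drop in degree. *)
pose K := (\sum_i \sum_j `|gdeg (i : 'I_(rk E)) - gdeg (j : 'I_(rk E))|%N).+1.
have NK : N ^+ K = 0.
  apply/matrixP => i j; rewrite mxE; apply/eqP; apply: contraT => /NX.
  have : (`|gdeg i - gdeg j|%N < K)%N.
    by rewrite ltnS (bigD1 i) //= (bigD1 j) //= -addnA leq_addr.
  by lia.
exists (\sum_(i < K) N ^+ i); split.
  elim/big_ind: _ => [i j|B C|i _]; last exact: graded_homX.
    by rewrite mxE; split; [exact: supported0|exact: homog0].
  exact: graded_homD.
have := subrX1 N K; rewrite NK sub0r => /(congr1 -%R).
by rewrite opprK -mulNr opprB subKr.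
Qed.

(** Lift the basis vectors one at a time, then keep only the component of each
coordinate that has the degree prescribed by homogeneity. *)
Lemma cover_lift (E E' : graded_free) m (h : 'I_m -> int)
    (d : 'M[{poly F}]_(rk E, m)) (d' : 'M_(rk E', m)) :
  (forall i j, homog (gdeg i - h j) (d i j)) ->
  (forall i j, homog (gdeg i - h j) (d' i j)) ->
  (forall i, exists2 w, free_elt supported w & row i d = w *m d') ->
  exists2 A : 'M_(rk E, rk E'), graded_hom supported A & d = A *m d'.
Proof.
move=> hd hd' lift; have /choice[w wP] : forall i, exists w,
    free_elt supported w /\ row i d = w *m d'.
  by move=> i; have [w] := lift i; exists w.
exists (\matrix_(i, j) hcomp (gdeg i - gdeg j) (w i 0 j)).
  move=> i j; rewrite mxE; split; last exact: homog_hcomp.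
  by apply: supported_hcomp; exact: (wP i).1.
apply/matrixP => i l; have /rowP /(_ l) := (wP i).2.
rewrite !mxE => /(congr1 (hcomp (gdeg i - h l))).
rewrite hcomp_homog // hcomp_sum => ->; apply: eq_bigr => k _.
by rewrite mxE -(hcompM _ _ (hd' k l)) subrKA.
Qed.

(** Uniqueness of graded projective covers. The two lifts of one cover through
the other compose to endomorphisms which differ from the identity by vectors in
the kernel of a cover, that is, by matrices without constant terms; such
endomorphisms are invertible. *)
Lemma cover_iso (E E' : graded_free) m (h : 'I_m -> int)
    (d : 'M[{poly F}]_(rk E, m)) (d' : 'M_(rk E', m)) :
  (forall i j, homog (gdeg i - h j) (d i j)) ->
  (forall i j, homog (gdeg i - h j) (d' i j)) ->
  (forall i, exists2 w, free_elt supported w & row i d = w *m d') ->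
  (forall i, exists2 w, free_elt supported w & row i d' = w *m d) ->
  (forall v, free_elt supported v -> v *m d = 0 -> forall j, (v 0 j)`_0 = 0) ->
  (forall v, free_elt supported v -> v *m d' = 0 -> forall j, (v 0 j)`_0 = 0) ->
  exists2 A : 'M_(rk E, rk E'), graded_iso supported A & d = A *m d'.
Proof.
move=> hd hd' dd' d'd kd kd'.
have [A hA dE] := cover_lift hd hd' dd'.
have [B hB d'E] := cover_lift hd' hd d'd.
have unip (E1 : graded_free) (d1 : 'M_(rk E1, m)) (C : 'M_(rk E1)) :
  (forall v, free_elt supported v -> v *m d1 = 0 -> forall j, (v 0 j)`_0 = 0) ->
  graded_hom supported C -> d1 = C *m d1 ->
  exists D : 'M_(rk E1), graded_hom supported D /\ C *m D = 1%:M.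
  move=> k1 hC d1E; apply: graded_hom_unipotent => // i j.
  have /k1 /(_ _ j): free_elt supported (row i (C - 1%:M)).
    move=> l; rewrite mxE; apply: graded_hom_supported.
    by apply: graded_homD => //; apply: graded_homN; exact: graded_hom1.
  rewrite -row_mul mulmxBl mul1mx -d1E subrr row0 => /(_ erefl).
  rewrite !mxE coefB => /eqP; rewrite subr_eq0 => /eqP ->.
  by case: eqP => _; rewrite ?coef1 ?coef0.
have [C [hC ABC]] : exists C : 'M_(rk E), graded_hom supported C /\ A *m B *m C = 1%:M.
  by apply: (unip _ d) => //; [exact: graded_homM|rewrite -mulmxA -d'E].
have [D [hD BAD]] : exists C : 'M_(rk E'), graded_hom supported C /\ B *m A *m C = 1%:M.
  by apply: (unip _ d') => //; [exact: graded_homM|rewrite -mulmxA -dE].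
exists A => //; split=> //; exists (B *m C).
have DBA : D *m (B *m A) = 1%:M by exact: mulmx1C.
split; [exact: graded_homM|by rewrite mulmxA|].
have -> : B *m C = D *m B.
  rewrite -[LHS]mul1mx -DBA -!mulmxA.
  by rewrite [A *m _]mulmxA ABC mulmx1.
by rewrite -mulmxA.
Qed.

End MonomialAlgebra.

(** * Uniqueness of minimal resolutions *)

Section Uniqueness.
Variables (F : fieldType) (G : set nat).
Hypothesis G0 : G 0%N.
Hypothesis GD : forall m n, G m -> G n -> G (m + n)%N.
Let S : set {poly F} := supported G.

Lemma free_eltM m n (v : 'rV_m) (A : 'M_(m, n)) :
  free_elt S v -> mx_supported G A -> free_elt S (v *m A).
Proof. by move=> /free_eltE Sv SA; apply/free_eltE; apply: mx_supportedM. Qed.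

Lemma free_elt_delta n (i : 'I_n) : free_elt S (delta_mx 0 i).
Proof.
move=> j; rewrite mxE eqxx /=.
by case: (j == i); [exact: supported1|exact: supported0].
Qed.

Lemma graded_iso_trans (E E' E'' : graded_free)
    (A : 'M_(rk E, rk E')) (B : 'M_(rk E', rk E'')) :
  graded_iso S A -> graded_iso S B -> graded_iso S (A *m B).
Proof.
move=> [hA [A' [hA' AA' A'A]]] [hB [B' [hB' BB' B'B]]].
split; first exact: graded_homM.
exists (B' *m A'); split; first exact: graded_homM.
  by rewrite mulmxA -(mulmxA A) BB' mulmx1.
by rewrite mulmxA -(mulmxA B') A'A mulmx1.
Qed.

Lemma graded_iso_shift s (E E' : graded_free) (A : 'M_(rk E, rk E')) :
  graded_iso S A -> @graded_iso F S (gshift s E) (gshift s E') A.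
Proof.
have hshift (E1 E2 : graded_free) (B : 'M_(rk E1, rk E2)) : graded_hom S B ->
    @graded_hom F S (gshift s E1) (gshift s E2) B.
  by move=> hB i j; have [SB dB] := hB i j; split; rewrite //= opprD addrACA subrr addr0.
by move=> [hA [B [hB AB BA]]]; split; [|exists B; split]; rewrite ?hshift //;
  exact: hshift.
Qed.

(** The isomorphisms are built by recursion on the homological degree. What must
be remembered about the n-th one is that it matches the images of the two
differentials that arrive there: composing with it, both modules in degree n.+1 become
covers of the same submodule, and uniqueness of covers gives the next
isomorphism. *)
Lemma minimal_resolution_iso (N : set {poly F}) (r r' : resolution F) :
  minimal_graded_free_resolution S N r ->
  minimal_graded_free_resolution S N r' ->
  exists A : forall n, 'M_(rk (res_mod r n), rk (res_mod r' n)),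
    forall n, graded_iso S (A n) /\
      res_diff r n *m A n = A n.+1 *m res_diff r' n.
Proof.
move=> [[hd haug Naug ker0 kerS] min] [[hd' haug' Naug' ker0' kerS'] min'].
pose im (r1 : resolution F) n (v : 'rV_(rk (res_mod r1 n))) :=
  exists2 w, free_elt S w & v = w *m res_diff r1 n.
pose good n (A : 'M_(rk (res_mod r n), rk (res_mod r' n))) :=
  graded_iso S A /\ forall v, free_elt S v -> (im r n v <-> im r' n (v *m A)).
have base : exists A0, good 0%N A0.
  have eq11 (u v : 'M[{poly F}]_(1, 1)) : u 0 0 = v 0 0 -> u = v.
    by move=> uv; apply/matrixP => i j; rewrite !ord1.
  have ker_const (r1 : resolution F) :
      minimal_graded_free_resolution S N r1 -> forall v, free_elt S v ->
      v *m res_aug r1 = 0 -> forall j, (v 0 j)`_0 = 0.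
    move=> [[_ _ _ k0 _] m0] v Sv /(k0 _ Sv) [w Sw ->] j.
    by have [] := m0 _ _ Sw j.
  have [A isoA dA] : exists2 A : 'M_(rk (res_mod r 0), rk (res_mod r' 0)),
      graded_iso S A & res_aug r = A *m res_aug r'.
    apply: (cover_iso G0 GD (h := fun=> 0)) => [i j|i j|i|i||].
    - by rewrite ord1 subr0; have [] := haug i.
    - by rewrite ord1 subr0; have [] := haug' i.
    - have [/Naug'[w Sw wE] _] := haug i; exists w => //.
      by apply: eq11; rewrite mxE.
    - have [/Naug[w Sw wE] _] := haug' i; exists w => //.
      by apply: eq11; rewrite mxE.
    - exact: ker_const.
    - exact: ker_const.
  exists A; split=> // v Sv; rewrite /im -ker0 // -ker0' ?dA ?mulmxA //.
  by apply: free_eltM => //; case: isoA => /graded_hom_supported.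
have step n (A : 'M_(rk (res_mod r n), rk (res_mod r' n))) : good n A ->
    exists A', good n.+1 A' /\ res_diff r n *m A = A' *m res_diff r' n.
  move=> [[hA [B [hB AB BA]]] imA].
  have SA := graded_hom_supported hA; have SB := graded_hom_supported hB.
  have Sd := graded_hom_supported (hd n).
  have Sd' := graded_hom_supported (hd' n).
  have [A' isoA' dA'] : exists2 A' : 'M_(rk (res_mod r n.+1), rk (res_mod r' n.+1)),
      graded_iso S A' & res_diff r n *m A = A' *m res_diff r' n.
    apply: (cover_iso G0 GD (h := @gdeg (res_mod r' n))) => [i j|i j|i|i|v Sv|v Sv].
    - by have [] := graded_homM GD (hd n) hA i j.
    - by have [] := hd' n i j.
    - rewrite row_mul; apply/(imA (row i (res_diff r n))).
        by move=> j; rewrite mxE; exact: Sd.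
      by exists (delta_mx 0 i); [exact: free_elt_delta|rewrite -rowE].
    - have Sv : free_elt S (row i (res_diff r' n) *m B).
        by apply: free_eltM => // j; rewrite mxE; exact: Sd'.
      have [w Sw wE] : im r n (row i (res_diff r' n) *m B).
        apply/(imA _ Sv); rewrite -mulmxA BA mulmx1.
        by exists (delta_mx 0 i); [exact: free_elt_delta|rewrite -rowE].
      by exists w => //; rewrite mulmxA -wE -mulmxA BA mulmx1.
    - rewrite mulmxA => /(congr1 (mulmx^~ B)); rewrite -mulmxA AB mulmx1 mul0mx.
      by move=> /(kerS _ _ Sv) [w Sw ->] j; have [] := min _ _ Sw j.
    - by move=> /(kerS' _ _ Sv) [w Sw ->] j; have [] := min' _ _ Sw j.
  exists A'; split => //; split=> // v Sv; rewrite /im -kerS // -kerS'; last first.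
    by apply: free_eltM => //; case: isoA' => /graded_hom_supported.
  rewrite -mulmxA -dA' mulmxA; split=> [->|/(congr1 (mulmx^~ B))].
    by rewrite mul0mx.
  by rewrite -mulmxA AB mulmx1 mul0mx.
have [A0 gA0] := cid base.
pose next n (A : {A | good n A}) : {A | good n.+1 A} :=
  let A' := cid (step n (sval A) (svalP A)) in exist _ (sval A') (svalP A').1.
pose A := nat_rect (fun n => {A | good n A}) (exist _ A0 gA0) next.
exists (fun n => sval (A n)) => n; split; first by have [] := svalP (A n).
by rewrite [A n.+1]/= /next; case: cid => A' [] /=.
Qed.

Lemma periodic2_transfer (N : set {poly F}) (r r' : resolution F) k :
  minimal_graded_free_resolution S N r ->
  minimal_graded_free_resolution S N r' ->
  periodic2_from S k r -> periodic2_from S k r'.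
Proof.
move=> min min' [s [P perP]].
have [A isoA] := minimal_resolution_iso min min'.
have exB : forall n, exists B : 'M_(rk (res_mod r' n), rk (res_mod r n)),
    [/\ graded_iso S B, A n *m B = 1%:M & B *m A n = 1%:M].
  move=> n; have [[hA [B [hB AB BA]]] _] := isoA n.
  by exists B; split=> //; split=> //; exists (A n).
pose B n := sval (cid (exB n)); have isoB n := svalP (cid (exB n)).
exists s, (fun n => B n.+2 *m P n *m A n) => n le_kn.
have [isoP dP] := perP n le_kn.
split.
  have [iB _ _] := isoB n.+2; have [iA _] := isoA n.
  exact: (@graded_iso_trans _ (gshift s (res_mod r n)) (gshift s (res_mod r' n)) _ _
    (@graded_iso_trans _ _ (gshift s (res_mod r n)) _ _ iB isoP) (graded_iso_shift s iA)).
have dB m : res_diff r' m *m B m = B m.+1 *m res_diff r m.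
  have [_ dA] := isoA m; have [_ _ BA] := isoB m.+1; have [_ AB _] := isoB m.
  by rewrite -[LHS]mul1mx -BA -mulmxA (mulmxA (A _)) -dA -mulmxA AB mulmx1.
by rewrite !mulmxA dB -(mulmxA (B n.+3)) dP -!mulmxA (isoA n).2.
Qed.

End Uniqueness.

(** * The semigroup generated by two integers and its algebra *)

Section Semigroup2.
Variables (a b : nat).
Let G := semigroup2 a b.

Lemma semigroup2_0 : G 0%N.
Proof. by exists 0%N, 0%N. Qed.

Lemma semigroup2D m n : G m -> G n -> G (m + n)%N.
Proof.
move=> [r [s ->]] [r' [s' ->]]; exists (r + r')%N, (s + s')%N.
by rewrite !mulnDl addnACA.
Qed.

(** Every element of the semigroup is a multiple of gcd(a, b), so a number that
is 1 modulo the gcd and lies beyond the last gap forces the gcd to be 1. *)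
Lemma semigroup2_coprime : (0 < a)%N -> numerical_semigroup G -> coprime a b.
Proof.
move=> a_gt0 [_ _ /finite_seqP[s sE]].
pose M := (\max_(i <- s) i)%N; pose n := (M.+1 * gcdn a b).+1.
have: G n.
  apply: contrapT => nG; have : n \in s by have : [set` s] n by rewrite -sE.
  move=> ns; have := @leq_bigmax_seq _ s predT id _ ns isT; rewrite -/M /n.
  have : (0 < gcdn a b)%N by rewrite gcdn_gt0 a_gt0.
  by clearbody M; nia.
move=> [u [v nE]]; rewrite /coprime -dvdn1.
rewrite -(@dvdn_addr (M.+1 * gcdn a b)%N) ?addn1 ?dvdn_mull // -/n nE.
by rewrite dvdn_add // dvdn_mull ?dvdn_gcdl ?dvdn_gcdr.
Qed.

(** Both sides are spanned by the monomials t^(r a + s b). *)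
Lemma subalg2E (F : fieldType) : subalg2 F a b = supported G.
Proof.
have GD := semigroup2D; have G0 := semigroup2_0.
apply/seteqP; split=> [_ [Q _ <-]|p Gp].
  rewrite horner_poly; apply: supported_sum => i _.
  apply: supportedM => //; last first.
    by rewrite -exprM; apply: supportedXn; exists 0%N, i; rewrite mulnC.
  rewrite comp_polyE; apply: supported_sum => j _; apply: supportedZ.
  by rewrite -exprM; apply: supportedXn; exists j, 0%N; rewrite addn0 mulnC.
pose ev (Q : {poly {poly F}}) := (map_poly (comp_poly 'X^a) Q).['X^b].
suff [Q <-] : exists Q, ev Q = p by exists Q.
have evD Q Q' : ev (Q + Q') = ev Q + ev Q' by rewrite /ev rmorphD hornerD.
have ev0 : ev 0 = 0 by rewrite /ev rmorph0 horner0.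
suff /choice[Q QE] : forall i : 'I_(size p), exists Q, ev Q = p`_i *: 'X^i.
  exists (\sum_i Q i); rewrite (big_morph _ evD ev0).
  by under eq_bigr do rewrite QE; rewrite -poly_def coefK.
move=> i; have [->|/Gp[r [s ->]]] := eqVneq p`_i 0.
  by exists 0; rewrite scale0r.
exists ((p`_(r * a + s * b) *: 'X^r)%:P * 'X^s); rewrite /ev.
rewrite rmorphM /= map_polyC map_polyXn /= hornerM hornerC hornerXn.
rewrite comp_polyZ rmorphXn /= comp_polyX -scalerAl -!exprM exprD.
by rewrite ![(_ * a)%N]mulnC ![(_ * b)%N]mulnC.
Qed.

End Semigroup2.

(** * The resolution of the algebra itself *)

Section FreeCase.
Variables (F : fieldType) (G : set nat).
Hypothesis G0 : G 0%N.
Hypothesis GD : forall m n, G m -> G n -> G (m + n)%N.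
Let S : set {poly F} := supported G.

Definition free_module (n : nat) : graded_free := GradedFree (fun _ : 'I_n => 0).

Definition free_resolution : resolution F :=
  @Resolution F (fun n => free_module (n == 0%N)) (fun n => 0) (const_mx 1).

Lemma free_resolution_minimal :
  minimal_graded_free_resolution S S free_resolution.
Proof.
have S0 : S 0 by exact: supported0.
split; last by move=> n w _ j; rewrite mulmx0 mxE; split; rewrite ?coef0.
split.
- by move=> n i j; rewrite mxE; split=> //; exact: homog0.
- by move=> j; rewrite mxE; split; [exact: supported1|exact: homog1].
- move=> p Sp; exists (const_mx p); first by move=> j; rewrite mxE.
  by rewrite mxE big_ord1 !mxE mulr1.
- move=> /= v Sv; split=> [/matrixP /(_ 0 0)|[w _ ->]].
    rewrite mxE big_ord1 !mxE mulr1 => v0; exists 0 => [j|].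
      by rewrite mxE.
    by apply/matrixP => i j; rewrite mulmx0 !ord1 v0 mxE.
  by rewrite mulmx0 mul0mx.
- move=> n /= v Sv; rewrite mulmx0; split=> // _; exists 0 => [j|].
    by rewrite mxE.
  by rewrite mulmx0; apply/matrixP => i [].
Qed.

Lemma free_resolution_periodic : periodic2_from S 1 free_resolution.
Proof.
exists 0, (fun=> 0) => -[//|n] _; split; last by rewrite !mulmx0.
split=> [[]//|].
by exists 0; split=> [[]//||]; apply/matrixP => -[].
Qed.

Lemma submod_gen_fset0 : submod_gen S [fset 0%N]%fset = S.
Proof.
apply/seteqP; split=> [p [c Sc ->]|p Sp]; rewrite ?big_seq_fset1 ?expr0 ?mulr1.
  exact: Sc.
by exists (fun=> p); rewrite // big_seq_fset1 expr0 mulr1.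
Qed.

End FreeCase.

(** * The staircase of a lean set *)

(** t^d is a multiple of t^c over the semigroup algebra. *)
Definition reach (a b d c : nat) := exists r s, d = (c + (r * a + s * b))%N.

Section Staircase.
Local Open Scope nat_scope.

(** The corner number k is the lattice point (x k, - z k), written with z k
rather than its opposite to stay within the natural numbers; e k is the exponent
that it represents. The last corner (b, -a) is the translate of the first one
that closes the cycle, so that e N = e 0 = 0. *)
Record staircase (a b N : nat) (e x z : nat -> nat) : Prop := Staircase {
  stairE : forall k, k <= N -> e k + z k * b = x k * a;
  stair_x0 : x 0 = 0;
  stair_xN : x N = b;
  stair_xlt : forall k, k < N -> x k < x k.+1;
  stair_z0 : z 0 = 0;
  stair_zN : z N = a;
  stair_zlt : forall k, k < N -> z k < z k.+1 }.

(** Lift i to the abscissa xi i < b which is determined by xi i * a = i mod b;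
as i is 0 or a gap, its ordinate is at most 0. If two lifts were comparable in
both coordinates, their difference would lie in the semigroup, against leanness;
so sorting by abscissa also sorts by decreasing ordinate. *)
Lemma lean_staircase (a b : nat) (I : {fset nat}) :
  0 < a -> 0 < b -> coprime a b -> lean_set (semigroup2 a b) I ->
  exists e x z, staircase a b #|` I| e x z /\
    perm_eq I [seq e k | k <- iota 0 #|` I|].
Proof.
move=> a_gt0 b_gt0 co_ab [I0 gapI gapB].
have lean i j r s : i \in I -> j \in I -> i + (r * a + s * b) = j -> i = j.
  move=> Ii Ij ijE; apply/eqP; apply: contraT => ij.
  have lt_ij : i < j by rewrite ltn_neqAle ij -ijE leq_addr.
  suff: gap (semigroup2 a b) (j - i) by case; exists r, s; rewrite -ijE addKn.
  have [i0|i0] := eqVneq i 0; last by apply: gapB => //; lia.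
  by rewrite i0 subn0; apply: gapI => //; lia.
have /choice[xi xiP] : forall i, exists x, x < b /\ x * a = i %[mod b].
  move=> i; have co_ba : coprime b a by rewrite coprime_sym.
  have := chinese_modl co_ba i 0; have := chinese_modr co_ba i 0.
  rewrite mod0n => /eqP /dvdnP[q ->] qi; exists (q %% b).
  by rewrite ltn_mod b_gt0 modnMml.
pose zeta i := (xi i * a - i) %/ b.
have zetaP i : i \in I -> i + zeta i * b = xi i * a.
  move=> Ii; have [_ xiE] := xiP i.
  suff le_i : i <= xi i * a.
    rewrite divnK ?subnKC //.
    by move/eqP: xiE; rewrite eqn_mod_dvd.
  rewrite leqNgt; apply/negP => lt_i.
  move/esym/eqP: xiE; rewrite eqn_mod_dvd ?(ltnW lt_i) // => /dvdnP[q iE].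
  have : 0 = i by apply: (lean 0 i (xi i) q) => //; lia.
  by lia.
have zeta_lt i j : i \in I -> j \in I -> xi i < xi j -> zeta i < zeta j.
  move=> Ii Ij lt_ij; rewrite ltnNge; apply/negP => le_ji.
  suff ij : i = j by rewrite ij ltnn in lt_ij.
  apply: (lean i j (xi j - xi i) (zeta i - zeta j)) => //.
  by have := zetaP i Ii; have := zetaP j Ij; nia.
have xi_inj i j : i \in I -> j \in I -> xi i = xi j -> i = j.
  move=> Ii Ij ij; wlog le_ji : i j Ii Ij ij / zeta j <= zeta i.
    by move=> hw; case/orP: (leq_total (zeta j) (zeta i)) => ?;
      [exact: hw|apply/esym/hw].
  apply: (lean i j 0 (zeta i - zeta j)) => //.
  by have := zetaP i Ii; have := zetaP j Ij; nia.
pose s := sort (relpre xi leq) I.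
have s_sz : size s = #|` I| by rewrite size_sort.
have s_mem i : (i \in s) = (i \in I) by rewrite mem_sort.
have s_nth k : k < #|` I| -> nth 0 s k \in I.
  by move=> ltk; rewrite -s_mem mem_nth ?s_sz.
have s_sorted : sorted (relpre xi leq) s.
  by apply: sort_sorted => i j; exact: leq_total.
pose N := #|` I|.
have N_gt0 : 0 < N by rewrite cardfs_gt0; apply/fset0Pn; exists 0.
have xi0 : xi 0 = 0.
  have [lt0 /eqP] := xiP 0; rewrite mod0n -/(_ %| _) Gauss_dvdl 1?coprime_sym //.
  by case: (xi 0) lt0 => // n ltn /dvdn_leq; lia.
have zeta0 : zeta 0 = 0 by have := zetaP 0 I0; rewrite xi0; nia.
have s00 : nth 0 s 0 = 0.
  apply: xi_inj; rewrite ?s_nth // xi0; apply/eqP; rewrite -leqn0.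
  have I0s : 0 \in s by rewrite s_mem.
  have xi_tr : transitive (relpre xi leq) by move=> i j k; exact: leq_trans.
  have xi_refl : reflexive (relpre xi leq) by move=> i; exact: leqnn.
  have := sorted_leq_nth xi_tr xi_refl 0 s_sorted.
  move=> /(_ 0 (index 0 s)); rewrite !inE index_mem I0s s_sz N_gt0 nth_index //=.
  by rewrite xi0; apply.
(* Beyond the end of s the default value 0 of nth is the exponent of the corner
   (b, -a). *)
exists (nth 0 s), (fun k => if k < N then xi (nth 0 s k) else b).
exists (fun k => if k < N then zeta (nth 0 s k) else a); split; last first.
  have -> : [seq nth 0 s k | k <- iota 0 #|` I|] = s.
    by rewrite -s_sz map_nth_iota0 // take_size.
  by rewrite perm_sym perm_sort.
have xi_lt k : k.+1 < N -> xi (nth 0 s k) < xi (nth 0 s k.+1).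
  move=> ltk; rewrite ltn_neqAle; apply/andP; split; last first.
    by apply: (sortedP 0 s_sorted); rewrite s_sz.
  apply/eqP => /xi_inj /eqP; rewrite !s_nth ?(ltnW ltk) // => /(_ isT isT).
  by rewrite nth_uniq ?s_sz ?(ltnW ltk) ?sort_uniq ?fset_uniq // ltn_eqF.
split=> [k lek|||k ltk|||k ltk]; rewrite ?N_gt0 ?ltnn ?s00 //.
- case: (ltnP k N) => lek'; first by apply: zetaP; exact: s_nth.
  by rewrite nth_default ?s_sz // mulnC.
- rewrite ltk; case: (ltnP k.+1 N) => [|_]; first exact: xi_lt.
  by case: (xiP (nth 0 s k)).
- rewrite ltk; case: (ltnP k.+1 N) => [ltk1|_].
    by apply: zeta_lt; rewrite ?s_nth ?xi_lt.
  rewrite -(ltn_pmul2r b_gt0); apply: leq_ltn_trans (leq_addl (nth 0 s k) _) _.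
  by rewrite zetaP ?s_nth // mulnC ltn_pmul2l //; case: (xiP (nth 0 s k)).
Qed.

Variables (a b N : nat) (e x z : nat -> nat).
Hypotheses (a_gt0 : 0 < a) (b_gt0 : 0 < b) (co_ab : coprime a b).
Hypothesis st : staircase a b N e x z.
Local Notation reach := (reach a b).

Definition syz k := e k + (x k.+1 - x k) * a.

Lemma stair_x_le k l : k <= l -> l <= N -> x k <= x l.
Proof.
move=> /subnK <-; elim: (l - k) => [//|m IH] lemN.
by apply: leq_trans (IH _) (ltnW (stair_xlt st _)) => //; exact: ltnW.
Qed.

Lemma stair_z_le k l : k <= l -> l <= N -> z k <= z l.
Proof.
move=> /subnK <-; elim: (l - k) => [//|m IH] lemN.
by apply: leq_trans (IH _) (ltnW (stair_zlt st _)) => //; exact: ltnW.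
Qed.

Lemma stair_e0 : e 0 = 0.
Proof. by have := stairE st (leq0n N); rewrite (stair_x0 st); lia. Qed.

Lemma stair_eN : e N = 0.
Proof.
by have := stairE st (leqnn N); rewrite (stair_xN st) (stair_zN st); lia.
Qed.

Lemma syz_corner k : k < N -> syz k + z k * b = x k.+1 * a.
Proof.
move=> ltk; have := stairE st (ltnW ltk); have := stair_xlt st ltk.
by rewrite /syz; nia.
Qed.

Lemma syzE2 k : k < N -> syz k = e k.+1 + (z k.+1 - z k) * b.
Proof.
move=> ltk; have := syz_corner ltk; have := stairE st ltk.
by have := stair_zlt st ltk; nia.
Qed.

Lemma reach_le d c : reach d c -> c <= d.
Proof. by move=> [r [s ->]]; exact: leq_addr. Qed.

Lemma reach_sub d c : reach d c -> semigroup2 a b (d - c).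
Proof. by move=> [r [s ->]]; rewrite addKn; exists r, s. Qed.

Lemma sub_reach d c : c <= d -> semigroup2 a b (d - c) -> reach d c.
Proof. by move=> le_cd [r [s E]]; exists r, s; rewrite -E subnKC. Qed.

Lemma reach_reduced d c : reach d c ->
  exists r s, r < b /\ d = c + (r * a + s * b).
Proof.
move=> [r [s ->]]; exists (r %% b), (s + r %/ b * a).
by rewrite ltn_mod; split=> //; have := divn_eq r b; nia.
Qed.

(** Two lattice points represent the same exponent only if they differ by a
multiple of (b, -a). *)
Lemma combination_eq p q p' q' :
  p * a + q * b = p' * a + q' * b -> p' <= p ->
  exists m, p = p' + m * b /\ q' = q + m * a.
Proof.
move=> eq le_p.
have : b %| (p - p') * a by apply/dvdnP; exists (q' - q); nia.
rewrite Gauss_dvdl 1?coprime_sym // => /dvdnP[m mE]; exists m.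
have pE : p = p' + m * b by lia.
by split=> //; nia.
Qed.

(** (p, q - w) is a lattice point of d which dominates the inner corner
(x j.+1, - z j) of the syzygy. *)
Lemma reach_syz d w p q j : j < N ->
  d + w * b = p * a + q * b -> x j.+1 <= p -> w <= q + z j -> reach d (syz j).
Proof.
move=> ltj dE le_x le_z; exists (p - x j.+1), (q + z j - w).
by have := syz_corner ltj; nia.
Qed.

(** Connectedness. Compare a point of d that dominates corner k with one that
dominates corner l, both exceeding their corner by less than b in abscissa. They
are equal, and then the inner corners between k and l are dominated; or the
latter is the translate of the former by (b, -a), and then the inner corners on
the complementary arc of the cycle, from l up to N and from 0 up to k, are. *)
Lemma reach_path d k l : k <= l -> l <= N -> reach d (e k) -> reach d (e l) ->
  (forall j, k <= j < l -> reach d (syz j)) \/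
  (forall j, l <= j < N -> reach d (syz j)) /\
  (forall j, j < k -> reach d (syz j)).
Proof.
move=> lekl lel /reach_reduced[r [s [ltr dk]]] /reach_reduced[r' [s' [ltr' dl]]].
have lek := leq_trans lekl lel.
have ek := stairE st lek; have el := stairE st lel.
have lex := stair_x_le lekl lel; have lez := stair_z_le lekl lel.
have lexN : x l <= b by rewrite -(stair_xN st) stair_x_le.
have lezN : z l <= a by rewrite -(stair_zN st) stair_z_le.
have dk' : d + z k * b = (x k + r) * a + s * b by lia.
have dl' : d + z l * b = (x l + r') * a + s' * b by lia.
have direct : x l + r' = x k + r -> forall j, k <= j < l -> reach d (syz j).
  move=> xE j /andP[lekj ltjl]; apply: (reach_syz _ dk').
  - exact: leq_trans ltjl lel.
  - by rewrite -xE; apply: leq_trans (stair_x_le ltjl lel) (leq_addr _ _).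
  - apply: leq_trans (stair_z_le lekj _) (leq_addl _ _).
    exact: leq_trans (ltnW ltjl) lel.
have pq : (x l + r') * a + (s' + z k) * b = (x k + r) * a + (s + z l) * b by lia.
case: (leqP (x k + r) (x l + r')) => le_p.
  have [m [pE qE]] := combination_eq pq le_p.
  case: m pE qE => [|[|m]] pE qE; first by left; apply: direct; lia.
  - right; split=> [j /andP[lelj ltjN]|j ltjk].
      apply: (reach_syz _ dl') => //.
        by have := stair_x_le ltjN (leqnn N); rewrite (stair_xN st); lia.
      exact: leq_trans (stair_z_le lelj (ltnW ltjN)) (leq_addl _ _).
    apply: (reach_syz _ dk'); first exact: leq_trans ltjk lek.
      exact: leq_trans (stair_x_le ltjk lek) (leq_addr _ _).
    by lia.
  - by nia.
have [m [pE qE]] := combination_eq (esym pq) (ltnW le_p).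
by case: m pE qE => [|m] pE qE; [left; apply: direct; lia|nia].
Qed.

Lemma stair_bracket r n : n <= N -> r < x n -> exists2 k, k < n & x k <= r < x k.+1.
Proof.
elim: n => [|n IH] len ltr; first by rewrite (stair_x0 st) in ltr.
case: (ltnP r (x n)) => [/(IH (ltnW len)) [k ltk xk]|le]; last first.
  by exists n; rewrite // le ltr.
by exists k => //; exact: ltnW.
Qed.

(** The syzygy N.-1, whose inner corner has abscissa b, provides a point of d with
abscissa b + r and r < b. If corner k is the last one with abscissa at most r,
then dominating the inner corner k, of abscissa greater than r, is only possible
for this point or those further to the right; so its ordinate is at least - z k,
and it dominates the translate of corner k by (b, 0), of exponent a b + e k. *)
Lemma reach_all_syz d : 0 < N -> (forall k, k < N -> reach d (syz k)) ->
  exists2 j, j < N & reach d (a * b + e j).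
Proof.
move=> N_gt0 all_s; have ltN : N.-1 < N by rewrite prednK.
have [r [v [ltr dN]]] := reach_reduced (all_s _ ltN).
have sN := syz_corner ltN; rewrite prednK // (stair_xN st) in sN.
have [k ltk /andP[lexk ltxk]] : exists2 k, k < N & x k <= r < x k.+1.
  by apply: stair_bracket; rewrite ?(stair_xN st).
have [r' [v' [ltr' dk]]] := reach_reduced (all_s _ ltk).
have sk := syz_corner ltk; have ek := stairE st (ltnW ltk).
have lexb : x k.+1 <= b by rewrite -(stair_xN st) stair_x_le.
have pq : (b + r) * a + (v + z k) * b = (x k.+1 + r') * a + (v' + z N.-1) * b.
  by lia.
have xE : b + r = x k.+1 + r'.
  case: (leqP (x k.+1 + r') (b + r)) => le.
    by have [[|m] [pE _]] := combination_eq pq le; nia.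
  by have [[|m] [pE _]] := combination_eq (esym pq) (ltnW le); nia.
exists k => //; exists (r - x k), v'.
have : d + z k * b = (b + r) * a + v' * b by rewrite xE; lia.
by move: lexk ek; nia.
Qed.

Lemma reach_cosyz j k : j < N -> k < N -> reach (a * b + e j) (syz k).
Proof.
move=> ltj ltk; have ej := stairE st (ltnW ltj); have sk := syz_corner ltk.
have lexb : x k.+1 <= b by rewrite -(stair_xN st) stair_x_le.
case: (leqP j k) => [lejk|ltkj].
  have lez := stair_z_le lejk (ltnW ltk).
  exists (b - x k.+1 + x j), (z k - z j).
  by nia.
have lez : z j <= a by rewrite -(stair_zN st) stair_z_le // ltnW.
have lex := stair_x_le ltkj (ltnW ltj).
exists (x j - x k.+1), (a + z k - z j).
by nia.
Qed.

(** Equality would force corner j and inner corner k to be (0, 0) and (b, 0),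
which only happens on a staircase with a single step. *)
Lemma cosyz_gt j k : 1 < N -> j < N -> k < N -> syz k < a * b + e j.
Proof.
move=> N_gt1 ltj ltk; have ej := stairE st (ltnW ltj); have sk := syz_corner ltk.
have lexb : x k.+1 <= b by rewrite -(stair_xN st) stair_x_le.
case: (leqP j k) => [lejk|ltkj].
  have lez := stair_z_le lejk (ltnW ltk).
  have : x k.+1 < b + x j \/ z j < z k; last by nia.
  have [->|j_gt0] := posnP j.
    have [->|k_gt0] := posnP k; last first.
      right; apply: leq_trans (stair_zlt st _) (stair_z_le k_gt0 (ltnW ltk)).
      exact: ltnW.
    left; rewrite (stair_x0 st) addn0 -(stair_xN st).
    exact: leq_trans (stair_xlt st _) (stair_x_le N_gt1 (leqnn N)).
  left; have := stair_x_le j_gt0 (ltnW ltj).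
  by have := stair_xlt st (ltnW N_gt1); lia.
have ltz : z j < a.
  by rewrite -(stair_zN st); apply: leq_trans (stair_zlt st ltj) (stair_z_le ltj _).
have lex := stair_x_le ltkj (ltnW ltj).
by nia.
Qed.

(** * The periodic resolution attached to a staircase *)

Local Open Scope ring_scope.

Variable F : fieldType.
Hypothesis N_gt1 : (1 < N)%N.

Let G := semigroup2 a b.
Let S : set {poly F} := supported G.
Let G0 : G 0%N := semigroup2_0 a b.
Let GD := @semigroup2D a b.
Let N_gt0 : (0 < N)%N := ltnW N_gt1.
Local Notation s := syz.

Definition stair_aug : 'cV[{poly F}]_N := \col_k 'X^(e k).

(** Row k is the relation between the generators k and k+1 (mod N): both terms
have degree [syz k]. *)
Definition stair_mx : 'M[{poly F}]_N :=
  \matrix_(k, l) ('X^((x k.+1 - x k) * a) *+ (l == k)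
                  - 'X^((z k.+1 - z k) * b) *+ (l == ordS k)).

(** The relation matrix lifts to the polynomial ring in two variables X, Y, over
the algebra, with determinant X^b - Y^a; this is the image of its adjugate. It is
the product of the column [stair_aug], of t^(a b), and of the row of all
t^(- syz k). *)
Definition costair_mx : 'M[{poly F}]_N :=
  \matrix_(j, k) 'X^(a * b + e j - s k).

Lemma e_ordS (k : 'I_N) : e (ordS k) = e k.+1.
Proof.
rewrite /=; case: (ltnP k.+1 N) => lek; first by rewrite modn_small.
have -> : k.+1 = N by apply/eqP; rewrite eqn_leq lek (ltn_ord k).
by rewrite modnn stair_e0 stair_eN.
Qed.

Lemma supported_nat (p : {poly F}) n : S p -> S (p *+ n).
Proof. by move=> Sp; rewrite -scaler_nat; exact: supportedZ. Qed.

Lemma homog_bool d (p : {poly F}) (c : bool) :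
  (c -> homog d p) -> homog d (p *+ c).
Proof. by case: c => [/(_ isT)//|_]; exact: homog0. Qed.

Lemma stair_mx_hom (k l : 'I_N) :
  S (stair_mx k l) /\ homog ((s k)%:Z - (e l)%:Z) (stair_mx k l).
Proof.
rewrite mxE; split.
  apply: supportedD; last apply: supportedN.
    apply: supported_nat; apply: supportedXn.
    by exists (x k.+1 - x k)%N, 0%N; rewrite addn0.
  by apply: supported_nat; apply: supportedXn; exists 0%N, (z k.+1 - z k)%N.
apply: homogD; last apply: homogN; apply: homog_bool => /eqP ->; apply: homogXn.
  by rewrite /syz; lia.
by rewrite e_ordS syzE2 //; lia.
Qed.

Lemma costair_mx_hom (j k : 'I_N) :
  S (costair_mx j k) /\
  homog ((a * b + e j)%N%:Z - (s k)%:Z) (costair_mx j k).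
Proof.
have r := reach_cosyz (ltn_ord j) (ltn_ord k).
rewrite mxE; split; first by apply: supportedXn; exact: reach_sub.
by apply: homogXn; have := reach_le r; lia.
Qed.

Lemma coef0_stair_mx (k l : 'I_N) : (stair_mx k l)`_0 = 0.
Proof.
rewrite mxE coefB !coefMn !coefXn.
have -> : (0 == (x k.+1 - x k) * a)%N = false.
  by have := stair_xlt st (ltn_ord k); nia.
have -> : (0 == (z k.+1 - z k) * b)%N = false.
  by have := stair_zlt st (ltn_ord k); nia.
by rewrite !mul0rn subr0.
Qed.

Lemma coef0_costair_mx (j k : 'I_N) : (costair_mx j k)`_0 = 0.
Proof.
rewrite mxE coefXn; have := cosyz_gt N_gt1 (ltn_ord j) (ltn_ord k).
by rewrite -subn_gt0 => /gtn_eqF; rewrite eq_sym => ->.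
Qed.

Lemma irrelevant_mulmx (A : 'M[{poly F}]_N) (w : 'rV_N) :
  mx_supported G A -> (forall j k, (A j k)`_0 = 0) ->
  free_elt S w -> free_elt (irrelevant_ideal S) (w *m A).
Proof.
move=> SA A0 Sw k; split; first exact: (free_eltM GD Sw SA).
by rewrite mxE coef_sum big1 // => j _; rewrite coef0M A0 mulr0.
Qed.

Lemma sum_delta (f : 'I_N -> {poly F}) (c : {poly F}) k :
  \sum_l (c *+ (l == k)) * f l = c * f k.
Proof.
rewrite (bigD1 k) //= eqxx big1 ?addr0 // => l /negPf ->.
by rewrite mulr0n mul0r.
Qed.

Lemma stair_mx_aug : stair_mx *m stair_aug = 0.
Proof.
apply/matrixP => k j; rewrite !mxE.
under eq_bigr do rewrite !mxE mulrBl.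
rewrite sumrB !sum_delta e_ordS -!exprD; apply/eqP; rewrite subr_eq0; apply/eqP.
have := syzE2 (ltn_ord k); rewrite /syz => sE.
by rewrite addnC sE addnC.
Qed.

(** After scaling by the degrees of the basis vectors, the relation matrix is the
boundary map of a cycle graph. *)
Lemma mul_stair_mx (w : 'rV_N) (l : 'I_N) :
  (w *m stair_mx) 0 l * 'X^(e l) =
  w 0 l * 'X^(s l) - w 0 (ord_pred l) * 'X^(s (ord_pred l)).
Proof.
have eS := e_ordS (ord_pred l); rewrite ord_predK in eS.
have -> : (w *m stair_mx) 0 l = w 0 l * 'X^((x l.+1 - x l) * a)
    - w 0 (ord_pred l) * 'X^((z (ord_pred l).+1 - z (ord_pred l)) * b).
  rewrite mxE; under eq_bigr do rewrite mxE mulrBr.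
  rewrite sumrB; congr (_ - _).
    rewrite (bigD1 l) //= eqxx big1 ?addr0 // => k /negPf kl.
    by rewrite eq_sym kl mulr0n mulr0.
  rewrite (bigD1 (ord_pred l)) //= ord_predK eqxx big1 ?addr0 // => k /negPf kl.
  by rewrite -(can2_eq (@ord_predK N) (@ordSK N)) eq_sym kl mulr0n mulr0.
rewrite mulrBl -!mulrA -!exprD; congr (_ * 'X^_ - _ * 'X^_).
  by rewrite /syz addnC.
by rewrite eS addnC -syzE2.
Qed.

Lemma stair_mx_ker (w : 'rV_N) :
  w *m stair_mx = 0 <->
  forall k l : 'I_N, w 0 k * 'X^(s k) = w 0 l * 'X^(s l).
Proof.
split=> [wD|wE]; last first.
  apply/rowP => l; rewrite [RHS]mxE; have := mul_stair_mx w l.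
  rewrite (wE l (ord_pred l)) subrr => /eqP.
  by rewrite mulf_eq0 expf_eq0 polyX_eq0 andbF orbF => /eqP.
pose k0 : 'I_N := Ordinal N_gt0.
suff w0 n (ltn : (n < N)%N) :
    w 0 (Ordinal ltn) * 'X^(s n) = w 0 k0 * 'X^(s 0%N).
  move=> [k ltk] [l ltl]; exact: etrans (w0 k ltk) (esym (w0 l ltl)).
elim: n ltn => [|n IH] ltn; first by congr (w 0 _ * _); exact: val_inj.
have := mul_stair_mx w (Ordinal ltn); rewrite wD mxE mul0r.
move/esym/eqP; rewrite subr_eq0 => /eqP ->.
have -> : ord_pred (Ordinal ltn) = Ordinal (ltnW ltn).
  by apply: (@ordS_inj N); rewrite ord_predK; apply: val_inj; rewrite /= modn_small.
exact: IH.
Qed.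

Lemma mul_costair_mx (w : 'rV_N) (k : 'I_N) :
  (w *m costair_mx) 0 k * 'X^(s k) = 'X^(a * b) * (w *m stair_aug) 0 0.
Proof.
rewrite !mxE mulr_suml mulr_sumr; apply: eq_bigr => j _; rewrite !mxE.
have := reach_le (reach_cosyz (ltn_ord j) (ltn_ord k)) => le.
by rewrite -mulrA -exprD subnK // exprD mulrCA.
Qed.

Lemma costair_mx_ker (w : 'rV_N) :
  w *m costair_mx = 0 <-> w *m stair_aug = 0.
Proof.
have X0 n : ('X^n : {poly F}) != 0 by rewrite expf_eq0 polyX_eq0 andbF.
split=> w0.
  apply/matrixP => i j; rewrite !ord1; apply: (mulfI (X0 (a * b)%N)).
  by rewrite -(mul_costair_mx w (Ordinal N_gt0)) w0 !mxE mul0r mulr0.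
apply/rowP => k; apply: (mulIf (X0 (s k))).
by rewrite mul_costair_mx w0 !mxE mul0r mulr0.
Qed.

(** A polynomial lies in the monomial submodule t^c M as soon as each of its
monomials does. *)
Lemma supported_generated c (p : {poly F}) :
  (forall d, p`_d != 0 -> exists2 j, (j < N)%N & reach d (c + e j)) ->
  exists2 w : 'rV_N, free_elt S w & p = 'X^c * (w *m stair_aug) 0 0.
Proof.
move=> pc; rewrite -[p]coefK poly_def.
elim/big_ind: _ => [|_ _ [w Sw ->] [w' Sw' ->]|d _].
- by exists 0 => [j|]; rewrite ?mul0mx !mxE ?mulr0 //; exact: supported0.
- exists (w + w') => [j|]; first by rewrite mxE; exact: supportedD (Sw j) (Sw' j).
  by rewrite mulmxDl [in RHS]mxE mulrDr.
have [->|/pc [j ltj rd]] := eqVneq p`_d 0.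
  exists 0 => [j|]; first by rewrite mxE; exact: supported0.
  by rewrite mul0mx mxE mulr0 scale0r.
exists ((p`_d *: 'X^(d - (c + e j))) *: delta_mx 0 (Ordinal ltj)) => [l|].
  rewrite !mxE eqxx /=; apply: supportedM => //.
    by apply: supportedZ; apply: supportedXn; exact: reach_sub.
  by case: (l == _); [exact: supported1|exact: supported0].
rewrite -scalemxAl mxE -rowE !mxE -scalerAl -scalerAr -!exprD.
by congr (_ *: 'X^_); have := reach_le rd; rewrite /=; lia.
Qed.

(** A kernel vector w is determined by the common value of the w_k t^(s_k), which lies in
all the R t^(s_k), hence in t^(a b) M by [reach_all_syz]. *)
Lemma stair_mx_exact (w : 'rV_N) : free_elt S w ->
  w *m stair_mx = 0 <-> exists2 w', free_elt S w' & w = w' *m costair_mx.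
Proof.
move=> Sw; split; last first.
  case=> w' _ ->; apply/stair_mx_ker => k l.
  by rewrite !mul_costair_mx.
move/stair_mx_ker => wE; pose k0 : 'I_N := Ordinal N_gt0.
have [d|w' Sw' w'E] := @supported_generated (a * b) (w 0 k0 * 'X^(s k0)).
  move=> nz; apply: reach_all_syz => // k ltk; move: nz.
  rewrite (wE k0 (Ordinal ltk)) coefMXn /=.
  case: ltnP => [_|le_d /Sw]; first by rewrite eqxx.
  exact: sub_reach.
exists w' => //; apply/rowP => k.
have X0 n : ('X^n : {poly F}) != 0 by rewrite expf_eq0 polyX_eq0 andbF.
by apply: (mulIf (X0 (s k))); rewrite mul_costair_mx -w'E; exact: wE.
Qed.

Definition im_stair (w : 'rV[{poly F}]_N) : Prop :=
  exists2 w', free_elt S w' & w = w' *m stair_mx.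

Lemma im_stair0 : im_stair 0.
Proof. by exists 0; rewrite ?mul0mx // => j; rewrite mxE; exact: supported0. Qed.

Lemma im_stairD w1 w2 : im_stair w1 -> im_stair w2 -> im_stair (w1 + w2).
Proof.
move=> [w1' S1 ->] [w2' S2 ->]; exists (w1' + w2'); last by rewrite mulmxDl.
by move=> j; rewrite mxE; exact: supportedD (S1 j) (S2 j).
Qed.

Lemma im_stairZ p w : S p -> im_stair w -> im_stair (p *: w).
Proof.
move=> Sp [w' Sw' ->]; exists (p *: w'); last by rewrite scalemxAl.
by move=> j; rewrite mxE; exact: supportedM (Sw' j).
Qed.

(** The multiple of degree d of the basis vector k. Indices are read modulo N, so
that paths of relations may run through N back to 0. *)
Definition monomial_at d k : 'rV[{poly F}]_N :=
  'X^(d - e k) *: \row_l (val l == (k %% N)%N)%:R.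

Lemma im_stair_step d k : (k < N)%N -> reach d (s k) ->
  im_stair (monomial_at d k - monomial_at d k.+1).
Proof.
move=> ltk rd; have le_d := reach_le rd.
have -> : monomial_at d k - monomial_at d k.+1 =
    'X^(d - s k) *: row (Ordinal ltk) stair_mx.
  apply/rowP => l; rewrite !mxE !mulr_natr mulrBr !mulrnAr -!exprD.
  rewrite -!val_eqE /= (modn_small ltk); congr ('X^_ *+ _ - 'X^_ *+ _).
    by move: le_d; rewrite /syz; move: ((_ - _) * a)%N => m; lia.
  by move: le_d; rewrite syzE2 //; move: ((_ - _) * b)%N => m; lia.
apply: im_stairZ; first by apply: supportedXn; exact: reach_sub.
exists (delta_mx 0 (Ordinal ltk)); last by rewrite -rowE.
exact: (@free_elt_delta F G (semigroup2_0 a b)).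
Qed.

Lemma im_stair_path d k l : (k <= l)%N -> (l <= N)%N ->
  (forall j, (k <= j < l)%N -> reach d (s j)) ->
  im_stair (monomial_at d k - monomial_at d l).
Proof.
move=> /subnK <-; elim: (l - k)%N => [|m IH] lem rd.
  by rewrite add0n subrr; exact: im_stair0.
rewrite -(subrKA (monomial_at d (m + k))); apply: im_stairD.
  apply: IH => [|j /andP[lek ltj]]; first exact: ltnW.
  by apply: rd; rewrite lek ltnW.
by apply: im_stair_step => //; apply: rd; rewrite leq_addl addSn ltnS leqnn.
Qed.

Lemma im_stair_connected d (k l : 'I_N) : reach d (e k) -> reach d (e l) ->
  im_stair (monomial_at d k - monomial_at d l).
Proof.
wlog le_kl : k l / (k <= l)%N => [hw|] rk rl.
  case/orP: (leq_total k l) => le; first exact: hw.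
  rewrite -opprB -scaleN1r; apply: im_stairZ (hw _ _ le rl rk).
  by apply: supportedN; exact: supported1.
have ltl := ltnW (ltn_ord l).
case: (reach_path le_kl ltl rk rl) => [rd|[rd rd']]; first exact: im_stair_path.
have mono0 : monomial_at d N = monomial_at d 0.
  by rewrite /monomial_at stair_e0 stair_eN modnn mod0n.
have := im_stairD (im_stair_path ltl (leqnn N) rd)
  (im_stair_path (leq0n k) (ltnW (ltn_ord k)) rd').
rewrite mono0 subrKA -opprB -scaleN1r => h.
rewrite -[X in im_stair X]scale1r -(opprK 1) -mulN1r -scalerA.
by apply: im_stairZ h; apply: supportedN; exact: supported1.
Qed.

(** A representative of degree d, common to all the generators that reach it: by
connectedness, all choices agree modulo the relations. *)
Definition monomial_rep d : 'rV[{poly F}]_N :=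
  if [pick k : 'I_N | `[< reach d (e k) >]] is Some k
  then monomial_at d k else 0.

Lemma monomial_repP d (k : 'I_N) : reach d (e k) ->
  im_stair (monomial_at d k - monomial_rep d).
Proof.
rewrite /monomial_rep => rk; case: pickP => [l /asboolP rl|/(_ k) /asboolP //].
exact: im_stair_connected.
Qed.

(** A linear section of the augmentation, restricted to polynomials of size at
most n; the bound makes it a sum over a fixed range, hence visibly additive. *)
Definition stair_normal n (p : {poly F}) : 'rV[{poly F}]_N :=
  \sum_(d < n) (p`_d)%:P *: monomial_rep d.

Lemma stair_normalP n (p : {poly F}) (k : 'I_N) :
  S p -> (size (p * 'X^(e k))%R <= n)%N ->
  im_stair (p *: delta_mx 0 k - stair_normal n (p * 'X^(e k))).
Proof.
move=> Sp le_n; set q := p * 'X^(e k).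
have rq d : q`_d != 0 -> reach d (e k).
  rewrite coefMXn; case: ltnP => [_|le_d /Sp]; first by rewrite eqxx.
  exact: sub_reach.
have -> : p *: delta_mx 0 k = \sum_(d < n) (q`_d)%:P *: monomial_at d k.
  have pE : p = \sum_(d < n) (q`_d)%:P * 'X^(d - e k).
    have X0 : ('X^(e k) : {poly F}) != 0 by rewrite expf_eq0 polyX_eq0 andbF.
    apply: (mulIf X0); rewrite -/q mulr_suml.
    have qE : q = \sum_(d < n) q`_d *: 'X^d.
      rewrite -poly_def; apply/polyP => d; rewrite coef_poly.
      by case: ltnP => // le_d; rewrite nth_default // (leq_trans le_n).
    rewrite {1}qE; apply: eq_bigr => d _; rewrite -mulrA -exprD -mul_polyC.
    have [->|/rq/reach_le le] := eqVneq q`_d 0; first by rewrite !mul0r.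
    by rewrite subnK.
  rewrite {1}pE scaler_suml; apply: eq_bigr => d _.
  rewrite /monomial_at -scalerA; congr (_ *: (_ *: _)).
  by apply/rowP => l; rewrite !mxE eqxx /= modn_small ?ltn_ord // -val_eqE.
rewrite /stair_normal -sumrB; elim/big_ind: _ => [||d _].
- exact: im_stair0.
- exact: im_stairD.
rewrite -scalerBr; have [->|/rq rd] := eqVneq q`_d 0.
  by rewrite scale0r; exact: im_stair0.
apply: im_stairZ (monomial_repP rd).
by rewrite -[(q`_d)%:P]mulr1 mul_polyC; apply: supportedZ; exact: supported1.
Qed.

(** Modulo the relations, w is congruent to the normal form of its image in M,
which is 0 if w is a syzygy. *)
Lemma stair_aug_exact (w : 'rV_N) : free_elt S w ->
  w *m stair_aug = 0 <-> exists2 w', free_elt S w' & w = w' *m stair_mx.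
Proof.
move=> Sw; split; last by case=> w' _ ->; rewrite -mulmxA stair_mx_aug mulmx0.
move=> w0; pose q k := w 0 k * 'X^(e k).
pose n := (\max_k size (q k))%N.
have nE : \sum_k stair_normal n (q k) = 0.
  rewrite exchange_big /= big1 // => d _; rewrite -scaler_suml -rmorph_sum -coef_sum /=.
  have -> : \sum_k q k = 0.
    move: w0 => /matrixP /(_ 0 0); rewrite !mxE => w0; rewrite -[RHS]w0.
    by apply: eq_bigr => k _; rewrite !mxE.
  by rewrite coef0 scale0r.
have -> : w = \sum_k (w 0 k *: delta_mx 0 k - stair_normal n (q k)).
  by rewrite sumrB nE subr0 -row_sum_delta.
elim/big_ind: _ => [||k _]; [exact: im_stair0|exact: im_stairD|].
apply: stair_normalP; first exact: Sw.
exact: (leq_bigmax k).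
Qed.

(** Each period of two steps adds a b to the degrees of the basis vectors. *)
Definition stair_module n : graded_free :=
  GradedFree (fun k : 'I_N =>
    ((if odd n then s k else e k) + n./2 * (a * b))%N%:Z).

Definition stair_resolution : resolution F :=
  @Resolution F stair_module
    (fun n => if odd n then costair_mx else stair_mx) stair_aug.

Lemma stair_resolution_minimal (M : set {poly F}) :
  (forall p, M p <->
     exists2 w : 'rV_N, free_elt S w & p = (w *m stair_aug) 0 0) ->
  minimal_graded_free_resolution S M stair_resolution.
Proof.
move=> ME.
have SD : mx_supported G stair_mx by move=> k l; case: (stair_mx_hom k l).
have SE : mx_supported G costair_mx by move=> k l; case: (costair_mx_hom k l).
split; last first.
  move=> n w Sw /=; case: ifP => _.
    by apply: irrelevant_mulmx => //; exact: coef0_costair_mx.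
  by apply: irrelevant_mulmx => //; exact: coef0_stair_mx.
split.
- move=> n /= k l; case: ifP => odd_n.
    have [Skl dkl] := costair_mx_hom k l; split=> //.
    rewrite /= uphalf_half odd_n /=; move: dkl; congr homog; lia.
  have [Skl dkl] := stair_mx_hom k l; split=> //.
  rewrite /= uphalf_half odd_n /=; move: dkl; congr homog; lia.
- move=> j; split.
    apply/ME; exists (delta_mx 0 j).
      exact: (@free_elt_delta F G (semigroup2_0 a b)).
    by rewrite -rowE [RHS]mxE.
  by rewrite mxE; apply: homogXn; rewrite /= addn0.
- by move=> p /ME.
- exact: stair_aug_exact.
- move=> n /= w Sw; case: (odd n) => /=.
    by rewrite costair_mx_ker; exact: stair_aug_exact.
  exact: stair_mx_exact.
Qed.

(** The matrices repeat after two steps and the degrees grow by a b, so that the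
identity matrices are the required isomorphisms. *)
Lemma stair_resolution_periodic k : periodic2_from S k stair_resolution.
Proof.
exists (a * b)%N%:Z, (fun=> 1%:M) => n _; split; last first.
  by rewrite /= negbK mulmx1 mul1mx.
have deg_eq (j : 'I_N) : gdeg (g := stair_module n.+2) j =
    gdeg (g := gshift (a * b)%N%:Z (stair_module n)) j.
  by rewrite /= negbK; lia.
have hom1 (i j : 'I_N) : S (1%:M i j) /\
    homog (gdeg (g := stair_module n.+2) i - gdeg (g := stair_module n.+2) j)
      (1%:M i j : {poly F}).
  exact: (@graded_hom1 F G (semigroup2_0 a b) (stair_module n.+2)).
split; first by move=> i j; rewrite -deg_eq; exact: hom1.
exists 1%:M; split; rewrite ?mulmx1 // => i j.
by rewrite -deg_eq; exact: hom1.
Qed.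

End Staircase.

(** * The periodicity theorem *)

Lemma submod_gen_stair (F : fieldType) (G : set nat) (I : {fset nat}) N
    (e : nat -> nat) : perm_eq I [seq e k | k <- iota 0 N] ->
  forall p : {poly F}, submod_gen (supported G) I p <->
    exists2 w : 'rV_N, free_elt (supported G) w & p = (w *m stair_aug N e F) 0 0.
Proof.
move=> permI p; set s := [seq e k | k <- iota 0 N] in permI.
have sumI (f : nat -> {poly F}) : \sum_(i <- I) f i = \sum_(k < N) f (e k).
  by rewrite (perm_big _ permI) /= big_map -[N in iota 0 N]subn0 big_mkord.
split=> [[c Sc ->]|[w Sw ->]].
  exists (\row_k c (e k)) => [j|]; first by rewrite mxE; exact: Sc.
  by rewrite sumI mxE; apply: eq_bigr => k _; rewrite !mxE.
have uniq_s : uniq s by rewrite -(perm_uniq permI) fset_uniq.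
pose c i := if insub (index i s) is Some k then w 0 k else 0.
exists c => [i|].
  by rewrite /c; case: insubP => [k _ _|_]; [exact: Sw|exact: supported0].
rewrite sumI mxE; apply: eq_bigr => k _; rewrite mxE; congr (_ * _).
rewrite /c (_ : e k = nth 0%N s k); last first.
  by rewrite (nth_map 0%N) ?size_iota // nth_iota.
by rewrite index_uniq ?size_map ?size_iota // valK.
Qed.

(* For I = {0} the module M_I is R itself, whose minimal resolution
   0 -> R -> M_I -> 0 repeats only from homological degree 1 on. *)
Theorem theorem4p1 (a b : nat) (F : fieldType) (I : {fset nat})
  (a_gt0 : (0 < a)%N) (lt_ab : (a < b)%N)
  (numG : numerical_semigroup (semigroup2 a b))
  (leanI : lean_set (semigroup2 a b) I) :
  let R := subalg2 F a b in
  let M := submod_gen R I in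
  (exists r : resolution F, minimal_graded_free_resolution R M r) /\
  (forall r : resolution F, minimal_graded_free_resolution R M r ->
     periodic2_from R (if I == [fset 0%N]%fset then 1%N else 0%N) r).
Proof.
rewrite /= subalg2E.
have G0 := semigroup2_0 a b; have GD := @semigroup2D a b.
suff [r min per] : exists2 r : resolution F,
    minimal_graded_free_resolution (supported (semigroup2 a b))
      (submod_gen (supported (semigroup2 a b)) I) r &
    periodic2_from (supported (semigroup2 a b))
      (if I == [fset 0%N]%fset then 1%N else 0%N) r.
  by split=> [|r' min']; [exists r|exact: (periodic2_transfer G0 GD min min')].
have [->|I_neq] := eqVneq I [fset 0%N]%fset.
  exists (free_resolution F); last exact: free_resolution_periodic.
  by rewrite submod_gen_fset0; exact: free_resolution_minimal.
have b_gt0 : (0 < b)%N := ltn_trans a_gt0 lt_ab.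
have co_ab := semigroup2_coprime a_gt0 numG.
have [e [x [z [st permI]]]] := lean_staircase a_gt0 b_gt0 co_ab leanI.
have I_gt1 : (1 < #|` I|)%N.
  rewrite ltnNge; apply: contraNN I_neq => le1; have [I0 _ _] := leanI.
  by rewrite eq_sym eqEfcard fsub1set I0 cardfs1.
exists (stair_resolution a b #|` I| e x z F).
  apply: stair_resolution_minimal => //; exact: submod_gen_stair.
exact: stair_resolution_periodic.
Qed.
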